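(* (Injective Dimension Theorem) Let $(\mathcal{C},\mathbb{E},\mathfrak{s})$ be an extriangulated category with enough injectives. Let $n\geq 1$ and let $E$ be an object of $\mathcal{C}$. The following statements are equivalent: (i) For every exact sequence of admissible morphisms $$E\rightarrowtail I^0\to\cdots\to I^{n-1}\twoheadrightarrow F$$ with each $I^m$, $0\leq m\leq n-1$, injective, the object $F$ is injective. (ii) There exists an exact sequence of admissible morphisms $$E\rightarrowtail I^0\to\cdots\to I^{n-1}\twoheadrightarrow I^n$$ with each $I^m$, $0\leq m\leq n$, injective.
   Context: Extriangulated categories (Nakaoka–Palu). Let $\mathcal{C}$ be an additive category and $\mathbb{E}\colon\mathcal{C}^{\mathrm{op}}\times\mathcal{C}\to\mathrm{Ab}$ an additive bifunctor. An element $\delta\in\mathbb{E}(C,A)$ is an $\mathbb{E}$-extension; for $a\colon A\to A'$ and $c\colon C'\to C$ write $a_*\delta=\mathbb{E}(C,a)(\delta)$ and $c^*\delta=\mathbb{E}(c,A)(\delta)$. A morphism of extensions $(a,c)\colon\delta\to\delta'$, with $\delta\in\mathbb{E}(C,A)$, $\delta'\in\mathbb{E}(C',A')$, is a pair $a\colon A\to A'$, $c\colon C\to C'$ with $a_*\delta=c^*\delta'$. The extension $\delta\oplus\delta'\in\mathbb{E}(C\oplus C',A\oplus A')$ is the one with components $(\delta,0,0,\delta')$. Sequences $A\xrightarrow{x}B\xrightarrow{y}C$ and $A\xrightarrow{x'}B'\xrightarrow{y'}C$ are equivalent if there is an isomorphism $b\colon B\to B'$ with $bx=x'$, $y'b=y$;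 $[A\xrightarrow{x}B\xrightarrow{y}C]$ denotes the equivalence class. A realization $\mathfrak{s}$ assigns to each $\delta\in\mathbb{E}(C,A)$ a class $\mathfrak{s}(\delta)=[A\to B\to C]$ such that for every morphism $(a,c)\colon\delta\to\delta'$ with $\mathfrak{s}(\delta)=[A\xrightarrow{x}B\xrightarrow{y}C]$, $\mathfrak{s}(\delta')=[A'\xrightarrow{x'}B'\xrightarrow{y'}C']$ there is $b\colon B\to B'$ with $bx=x'a$, $y'b=cy$. It is additive if $\mathfrak{s}(0)=[A\to A\oplus C\to C]$ (canonical maps) for $0\in\mathbb{E}(C,A)$ and $\mathfrak{s}(\delta\oplus\delta')=\mathfrak{s}(\delta)\oplus\mathfrak{s}(\delta')$. The triple $(\mathcal{C},\mathbb{E},\mathfrak{s})$ is an extriangulated category if $\mathfrak{s}$ is an additive realization and the following hold. (ET3) If $\delta,\delta'$ are realized by $A\xrightarrow{x}B\xrightarrow{y}C$ and $A'\xrightarrow{x'}B'\xrightarrow{y'}C'$ and $a,b$ satisfy $bx=x'a$, there is $c\colon C\to C'$ with $cy=y'b$ and $a_*\delta=c^*\delta'$. (ET3)$^{\mathrm{op}}$ Dually, if $b,c$ satisfy $y'b=cy$, there is $a\colon A\to A'$ with $x'a=bx$ and $a_*\delta=c^*\delta'$. (ET4) If $\delta\in\mathbb{E}(D,A)$, $\delta'\in\mathbb{E}(F,B)$ are realized by $A\xrightarrow{f}B\xrightarrow{f'}D$ and $B\xrightarrow{g}C\xrightarrow{g'}F$, there are an object $E$, morphisms $d\colon D\to E$,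 $e\colon E\to F$, $h'\colon C\to E$ and $\delta''\in\mathbb{E}(E,A)$ realized by $A\xrightarrow{h}C\xrightarrow{h'}E$ with $h=gf$, $h'g=df'$, $eh'=g'$, such that $D\xrightarrow{d}E\xrightarrow{e}F$ realizes $f'_*\delta'$, $d^*\delta''=\delta$, and $f_*\delta''=e^*\delta'$. (ET4)$^{\mathrm{op}}$ If $\delta\in\mathbb{E}(B,D)$, $\delta'\in\mathbb{E}(C,F)$ are realized by $D\xrightarrow{f'}A\xrightarrow{f}B$ and $F\xrightarrow{g'}B\xrightarrow{g}C$, there are an object $E$, morphisms $d\colon D\to E$, $e\colon E\to F$, $h'\colon E\to A$ and $\delta''\in\mathbb{E}(C,E)$ realized by $E\xrightarrow{h'}A\xrightarrow{h}C$ with $h=gf$, $h'd=f'$, $fh'=g'e$, such that $D\xrightarrow{d}E\xrightarrow{e}F$ realizes $g'^*\delta$, $e_*\delta''=\delta'$, and $d_*\delta=g^*\delta''$. If $A\xrightarrow{x}B\xrightarrow{y}C$ realizes $\delta\in\mathbb{E}(C,A)$, it is called a conflation, $x$ an inflation ($\rightarrowtail$), $y$ a deflation ($\twoheadrightarrow$), and the pair, written $A\xrightarrow{x}B\xrightarrow{y}C\overset{\delta}{\dashrightarrow}$, an $\mathbb{E}$-triangle. An object $I$ is injective if for every $\mathbb{E}$-triangle $A\xrightarrow{x}B\xrightarrow{y}C\dashrightarrow$ and every $f\colon A\to I$ there is $g\colon B\to I$ with $gx=f$. $\mathcal{C}$ has enough injectives if every object $A$ admits an $\mathbb{E}$-triangle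 $A\to I\to C\dashrightarrow$ with $I$ injective. Exact sequences of admissible morphisms: an exact sequence of admissible morphisms $E\rightarrowtail I^0\to\cdots\to I^{n-1}\twoheadrightarrow F$ means that there are objects $G^0,\dots,G^n$ with $G^0\cong E$, $G^n=F$ and conflations $G^m\rightarrowtail I^m\twoheadrightarrow G^{m+1}$ for $0\leq m\leq n-1$, such that $E\to I^0$ is the composite $E\cong G^0\rightarrowtail I^0$, each $I^{m-1}\to I^{m}$ ($1\leq m\leq n-1$) is the composite $I^{m-1}\twoheadrightarrow G^m\rightarrowtail I^m$, and $I^{n-1}\to F$ is the deflation $I^{n-1}\twoheadrightarrow G^n$. In (ii) this is applied with $F=I^n$. *)

(* Defs.v *)
From mathcomp Require Import all_boot ssralg.

Set Implicit Arguments.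
Unset Strict Implicit.
Unset Printing Implicit Defensive.

Import GRing.Theory.
Local Open Scope ring_scope.

Declare Scope excat_scope.
Delimit Scope excat_scope with excat.

(* The zero object and the binary biproducts are chosen as part of the
   structure. *)
Record additive_category := AdditiveCategory {
  obj :> Type;
  mor : obj -> obj -> zmodType;
  idm : forall A, mor A A;
  compm : forall A B C, mor B C -> mor A B -> mor A C;
  comp1m : forall A B (f : mor A B), compm (idm B) f = f;
  compm1 : forall A B (f : mor A B), compm f (idm A) = f;
  compmA : forall A B C D (h : mor C D) (g : mor B C) (f : mor A B),
    compm h (compm g f) = compm (compm h g) f;
  compmDl : forall A B C (g g' : mor B C) (f : mor A B),
    compm (g + g') f = compm g f + compm g' f;
  compmDr : forall A B C (g : mor B C) (f f' : mor A B),
    compm g (f + f') = compm g f + compm g f';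
  zobj : obj;
  mor_to_zobj : forall A (f : mor A zobj), f = 0;
  mor_from_zobj : forall A (f : mor zobj A), f = 0;
  dsum : obj -> obj -> obj;
  inc1 : forall A B, mor A (dsum A B);
  inc2 : forall A B, mor B (dsum A B);
  prj1 : forall A B, mor (dsum A B) A;
  prj2 : forall A B, mor (dsum A B) B;
  prj1_inc1 : forall A B, compm (prj1 A B) (inc1 A B) = idm A;
  prj1_inc2 : forall A B, compm (prj1 A B) (inc2 A B) = 0;
  prj2_inc1 : forall A B, compm (prj2 A B) (inc1 A B) = 0;
  prj2_inc2 : forall A B, compm (prj2 A B) (inc2 A B) = idm B;
  dsum_id : forall A B,
    compm (inc1 A B) (prj1 A B) + compm (inc2 A B) (prj2 A B) = idm (dsum A B)
}.

Arguments mor {a} _ _.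
Arguments idm {a} A.
Arguments compm {a A B C} _ _.
Arguments dsum {a} _ _.
Arguments inc1 {a} A B.
Arguments inc2 {a} A B.
Arguments prj1 {a} A B.
Arguments prj2 {a} A B.

Notation "g ∘ f" := (compm g f) (at level 40, left associativity) : excat_scope.
Local Open Scope excat_scope.

Definition is_iso (C : additive_category) (X Y : C) (f : mor X Y) : Prop :=
  exists g : mor Y X, g ∘ f = idm X /\ f ∘ g = idm Y.

Definition dsum_map (C : additive_category) (X X' Y Y' : C)
    (f : mor X Y) (f' : mor X' Y') : mor (dsum X X') (dsum Y Y') :=
  inc1 Y Y' ∘ f ∘ prj1 X X' + inc2 Y Y' ∘ f' ∘ prj2 X X'.

(* Biadditive functors from C^op x C to abelian groups, contravariant in the
   first variable. *)
Record additive_bifunctor (C : additive_category) := AdditiveBifunctor {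
  ext :> C -> C -> zmodType;
  ext_map : forall (X X' A A' : C) (c : mor X' X) (a : mor A A'),
    {additive ext X A -> ext X' A'};
  ext_map_id : forall (X A : C) (d : ext X A), ext_map (idm X) (idm A) d = d;
  ext_map_comp : forall (X X' X'' A A' A'' : C)
      (c : mor X' X) (c' : mor X'' X') (a : mor A A') (a' : mor A' A'')
      (d : ext X A),
    ext_map (c ∘ c') (a' ∘ a) d = ext_map c' a' (ext_map c a d);
  ext_mapDl : forall (X X' A A' : C) (c c' : mor X' X) (a : mor A A')
      (d : ext X A),
    ext_map (c + c') a d = ext_map c a d + ext_map c' a d;
  ext_mapDr : forall (X X' A A' : C) (c : mor X' X) (a a' : mor A A')
      (d : ext X A),
    ext_map c (a + a') d = ext_map c a d + ext_map c a' d
}.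

Section Extensions.

Variables (C : additive_category) (Ext : additive_bifunctor C).

Definition push (X A A' : C) (a : mor A A') (d : Ext X A) : Ext X A' :=
  ext_map Ext (idm X) a d.

Definition pull (X X' A : C) (c : mor X' X) (d : Ext X A) : Ext X' A :=
  ext_map Ext c (idm A) d.

Definition ext_morphism (X A X' A' : C) (d : Ext X A) (d' : Ext X' A')
    (a : mor A A') (c : mor X X') : Prop :=
  push a d = pull c d'.

(* The lemmas ext_dsum_components and ext_dsum_unique below say that this is
   the unique extension with components (d, 0, 0, d'). *)
Definition ext_dsum (X A X' A' : C) (d : Ext X A) (d' : Ext X' A') :
    Ext (dsum X X') (dsum A A') :=
  push (inc1 A A') (pull (prj1 X X') d) + push (inc2 A A') (pull (prj2 X X') d').

Lemma push_pullE (X X' A A' : C) (c : mor X' X) (a : mor A A') (d : Ext X A) :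
  push a (pull c d) = ext_map Ext c a d.
Proof. by rewrite /push /pull -ext_map_comp compm1 compm1. Qed.

Lemma ext_map0l (X X' A A' : C) (a : mor A A') (d : Ext X A) :
  ext_map Ext (0 : mor X' X) a d = 0.
Proof. by apply: (addrI (ext_map Ext 0 a d)); rewrite -ext_mapDl !addr0. Qed.

Lemma ext_map0r (X X' A A' : C) (c : mor X' X) (d : Ext X A) :
  ext_map Ext c (0 : mor A A') d = 0.
Proof. by apply: (addrI (ext_map Ext c 0 d)); rewrite -ext_mapDr !addr0. Qed.

Lemma ext_dsum_components (X A X' A' : C) (d : Ext X A) (d' : Ext X' A') :
  [/\ push (prj1 A A') (pull (inc1 X X') (ext_dsum d d')) = d,
      push (prj1 A A') (pull (inc2 X X') (ext_dsum d d')) = 0,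
      push (prj2 A A') (pull (inc1 X X') (ext_dsum d d')) = 0
    & push (prj2 A A') (pull (inc2 X X') (ext_dsum d d')) = d'].
Proof.
by rewrite !push_pullE /ext_dsum !push_pullE !raddfD /= -!ext_map_comp
  !(prj1_inc1, prj1_inc2, prj2_inc1, prj2_inc2) !(ext_map0l, ext_map0r, ext_map_id)
  ?(addr0, add0r).
Qed.

Lemma ext_dsum_unique (X A X' A' : C) (t u : Ext (dsum X X') (dsum A A')) :
  push (prj1 A A') (pull (inc1 X X') t) = push (prj1 A A') (pull (inc1 X X') u) ->
  push (prj1 A A') (pull (inc2 X X') t) = push (prj1 A A') (pull (inc2 X X') u) ->
  push (prj2 A A') (pull (inc1 X X') t) = push (prj2 A A') (pull (inc1 X X') u) ->
  push (prj2 A A') (pull (inc2 X X') t) = push (prj2 A A') (pull (inc2 X X') u) ->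
  t = u.
Proof.
rewrite !push_pullE => h11 h12 h21 h22.
have dec (v : Ext (dsum X X') (dsum A A')) :
    v = ext_map Ext (prj1 X X') (inc1 A A') (ext_map Ext (inc1 X X') (prj1 A A') v)
      + ext_map Ext (prj1 X X') (inc2 A A') (ext_map Ext (inc1 X X') (prj2 A A') v)
     + (ext_map Ext (prj2 X X') (inc1 A A') (ext_map Ext (inc2 X X') (prj1 A A') v)
      + ext_map Ext (prj2 X X') (inc2 A A') (ext_map Ext (inc2 X X') (prj2 A A') v)).
  by rewrite -!ext_map_comp -!ext_mapDr -ext_mapDl !dsum_id ext_map_id.
by rewrite (dec t) (dec u) h11 h12 h21 h22.
Qed.

End Extensions.

Definition seq_equiv (C : additive_category) (A X : C)
    (B : C) (x : mor A B) (y : mor B X)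
    (B' : C) (x' : mor A B') (y' : mor B' X) : Prop :=
  exists b : mor B B', [/\ is_iso b, b ∘ x = x' & y' ∘ b = y].

(* A set of sequences A -> B -> X with fixed ends. *)
Definition seq_class (C : additive_category) (A X : C) : Type :=
  forall B : C, mor A B -> mor B X -> Prop.

(* [s d B x y] means that A -x-> B -y-> X belongs to the class s(d). *)
Definition correspondence (C : additive_category) (Ext : additive_bifunctor C)
    : Type :=
  forall A X : C, Ext X A -> seq_class A X.

Section Extriangulated.

Variables (C : additive_category) (Ext : additive_bifunctor C).
Variable s : correspondence Ext.

Definition realizes (A B X : C) (d : Ext X A) (x : mor A B) (y : mor B X)
    : Prop :=
  s d x y.

Record realization : Prop := Realization {
  realization_class : forall (A X : C) (d : Ext X A),
    exists (B : C) (x : mor A B) (y : mor B X),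
    forall (B' : C) (x' : mor A B') (y' : mor B' X),
      realizes d x' y' <-> seq_equiv x y x' y';
  realization_map : forall (A B X A' B' X' : C)
      (d : Ext X A) (x : mor A B) (y : mor B X)
      (d' : Ext X' A') (x' : mor A' B') (y' : mor B' X')
      (a : mor A A') (c : mor X X'),
    realizes d x y -> realizes d' x' y' -> ext_morphism d d' a c ->
    exists b : mor B B', b ∘ x = x' ∘ a /\ y' ∘ b = c ∘ y
}.

(* As s(d) is a full equivalence class, s(d) = [A -> B -> X] is expressed by
   membership of the representative. *)
Record additive_realization : Prop := AdditiveRealization {
  additive_realization_realization : realization;
  additive_realization0 : forall A X : C,
    realizes (0 : Ext X A) (inc1 A X) (prj2 A X);
  additive_realization_dsum : forall (A B X A' B' X' : C)
      (d : Ext X A) (x : mor A B) (y : mor B X)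
      (d' : Ext X' A') (x' : mor A' B') (y' : mor B' X'),
    realizes d x y -> realizes d' x' y' ->
    realizes (ext_dsum d d') (dsum_map x x') (dsum_map y y')
}.

Definition ET3 : Prop :=
  forall (A B X A' B' X' : C)
    (d : Ext X A) (x : mor A B) (y : mor B X)
    (d' : Ext X' A') (x' : mor A' B') (y' : mor B' X')
    (a : mor A A') (b : mor B B'),
  realizes d x y -> realizes d' x' y' -> b ∘ x = x' ∘ a ->
  exists c : mor X X', c ∘ y = y' ∘ b /\ ext_morphism d d' a c.

Definition ET3op : Prop :=
  forall (A B X A' B' X' : C)
    (d : Ext X A) (x : mor A B) (y : mor B X)
    (d' : Ext X' A') (x' : mor A' B') (y' : mor B' X')
    (b : mor B B') (c : mor X X'),
  realizes d x y -> realizes d' x' y' -> y' ∘ b = c ∘ y ->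
  exists a : mor A A', x' ∘ a = b ∘ x /\ ext_morphism d d' a c.

Definition ET4 : Prop :=
  forall (A B X D F : C) (dl : Ext D A) (dl' : Ext F B)
    (f : mor A B) (f' : mor B D) (g : mor B X) (g' : mor X F),
  realizes dl f f' -> realizes dl' g g' ->
  exists (E : C) (d : mor D E) (e : mor E F) (h : mor A X) (h' : mor X E)
    (dl'' : Ext E A),
    realizes dl'' h h' /\
    [/\ h = g ∘ f, h' ∘ g = d ∘ f' & e ∘ h' = g'] /\
    [/\ realizes (push f' dl') d e, pull d dl'' = dl
      & push f dl'' = pull e dl'].

Definition ET4op : Prop :=
  forall (A B X D F : C) (dl : Ext B D) (dl' : Ext X F)
    (f' : mor D A) (f : mor A B) (g' : mor F B) (g : mor B X),
  realizes dl f' f -> realizes dl' g' g ->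
  exists (E : C) (d : mor D E) (e : mor E F) (h' : mor E A) (h : mor A X)
    (dl'' : Ext X E),
    realizes dl'' h' h /\
    [/\ h = g ∘ f, h' ∘ d = f' & f ∘ h' = g' ∘ e] /\
    [/\ realizes (pull g' dl) d e, push e dl'' = dl'
      & push d dl = pull g dl''].

Record extriangulated : Prop := Extriangulated {
  extriangulated_realization : additive_realization;
  extriangulated_ET3 : ET3;
  extriangulated_ET3op : ET3op;
  extriangulated_ET4 : ET4;
  extriangulated_ET4op : ET4op
}.

Definition conflation (A B X : C) (x : mor A B) (y : mor B X) : Prop :=
  exists d : Ext X A, realizes d x y.

Definition injective_object (I : C) : Prop :=
  forall (A B X : C) (x : mor A B) (y : mor B X) (d : Ext X A),
  realizes d x y ->
  forall f : mor A I, exists g : mor B I, g ∘ x = f.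

Definition enough_injectives : Prop :=
  forall A : C, exists (I X : C) (x : mor A I) (y : mor I X) (d : Ext X A),
    injective_object I /\ realizes d x y.

(* E -i-> I 0 -d 0-> I 1 -> ... -> I n.-1 -p-> F, for n >= 1.  Only the I m with
   m < n and the d m with m.+1 < n are meaningful.  G is the family of G^m for
   m < n; the remaining object G^n is F itself, so that the last conflation is
   G n.-1 -k-> I n.-1 -p-> F. *)
Definition admissible_exact (n : nat) (E F : C) (I : nat -> C)
    (i : mor E (I 0)) (d : forall m, mor (I m) (I m.+1)) (p : mor (I n.-1) F)
    : Prop :=
  exists (G : nat -> C) (k : forall m, mor (G m) (I m))
    (q : forall m, mor (I m) (G m.+1)) (phi : mor E (G 0)),
    [/\ forall m, (m.+1 < n)%N -> conflation (k m) (q m),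
        conflation (k n.-1) p,
        is_iso phi,
        i = k 0 ∘ phi
      & forall m, (m.+1 < n)%N -> d m = k m.+1 ∘ q m].

End Extriangulated.

(* Main.v *)
Require Import Defs.
From mathcomp Require Import all_boot ssralg.

(** Call [G] a stable retract of [H] if there are [u : G -> H], [v : H -> G]
  with [v u - 1] factoring through an injective object.  A stable retract of an
  injective object is injective, and stable retracts pass to cosyzygies: given
  conflations [G -> I -> G'] (realizing [delta]) and [H -> J -> H'] with [I] and
  [J] injective, [u] and [v] extend to [u'] and [v'], and
  [(v' u')^* delta = (v u)_* delta = delta] since maps into injectives kill
  [delta]; hence [v' u' - 1] lifts along the deflation [I -> G'].  Applied along
  two resolutions of [E] this replaces Schanuel's lemma. *)

Import GRing.Theory.
Local Open Scope ring_scope.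
Local Open Scope excat_scope.

Section InjectiveDimension.

Set Implicit Arguments.
Unset Strict Implicit.

Variables (C : additive_category) (Ext : additive_bifunctor C).

Lemma comp0m (X Y Z : C) (f : mor X Y) : (0 : mor Y Z) ∘ f = 0.
Proof. by apply: (addrI (0 ∘ f)); rewrite -compmDl !addr0. Qed.

Lemma compNm (X Y Z : C) (g : mor Y Z) (f : mor X Y) : (- g) ∘ f = - (g ∘ f).
Proof. by apply: (addrI (g ∘ f)); rewrite -compmDl !subrr comp0m. Qed.

Lemma push_comp (X A A' A'' : C) (a : mor A A') (a' : mor A' A'')
  (d : Ext X A) : push (a' ∘ a) d = push a' (push a d).
Proof. by rewrite /push -ext_map_comp compm1. Qed.

Lemma pull_comp (X X' X'' A : C) (c : mor X' X) (c' : mor X'' X')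
  (d : Ext X A) : pull (c ∘ c') d = pull c' (pull c d).
Proof. by rewrite /pull -ext_map_comp compm1. Qed.

Lemma pull_push (X X' A A' : C) (c : mor X' X) (a : mor A A') (d : Ext X A) :
  pull c (push a d) = push a (pull c d).
Proof. by rewrite push_pullE /pull /push -ext_map_comp comp1m comp1m. Qed.

Variable s : correspondence Ext.
Hypothesis hC : extriangulated s.

(** (ET3) applied to the square from [x] to the split inflation of [B] into its sum with the zero
    object makes [push x d] a pullback of the zero extension. *)
Lemma push_inflation (A B X : C) (d : Ext X A) (x : mor A B) (y : mor B X) :
  realizes s d x y -> push x d = 0.
Proof.
move=> hd.
have h0 := additive_realization0 (extriangulated_realization hC) B (zobj C).
have [c [_ ->]] := extriangulated_ET3 hC hd h0 (erefl (inc1 _ _ ∘ x)).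
exact: raddf0.
Qed.

(** [(idm A, c)] is a morphism from the split extension to [d]; its middle map, restricted to the
    summand [X'], is the lift. *)
Lemma deflation_lift (A B X X' : C) (d : Ext X A) (x : mor A B) (y : mor B X)
    (c : mor X' X) :
  realizes s d x y -> pull c d = 0 -> exists z : mor X' B, y ∘ z = c.
Proof.
move=> hd hc.
have hR := extriangulated_realization hC.
have hm : ext_morphism (0 : Ext X' A) d (idm A) c.
  by rewrite /ext_morphism hc; exact: raddf0.
have [b [_ hb]] := realization_map (additive_realization_realization hR)
  (additive_realization0 hR A X') hd hm.
by exists (b ∘ inc2 A X'); rewrite compmA hb -compmA prj2_inc2 compm1.
Qed.

Lemma push_into_injective (A B X P : C) (d : Ext X A) (x : mor A B)
    (y : mor B X) (t : mor A P) :
  realizes s d x y -> injective_object s P -> push t d = 0.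
Proof.
move=> hd hP; have [t' <-] := hP _ _ _ _ _ _ hd t.
by rewrite push_comp (push_inflation hd); exact: raddf0.
Qed.

Definition stable_retract (G H : C) : Prop :=
  exists (u : mor G H) (v : mor H G) (P : C) (t : mor G P) (w : mor P G),
    injective_object s P /\ v ∘ u = idm G + w ∘ t.

Lemma stable_retract_injective (G H : C) :
  stable_retract G H -> injective_object s H -> injective_object s G.
Proof.
move=> [u [v [P [t [w [hP huv]]]]]] hH A B X x y d hd f.
have [g1 hg1] := hH _ _ _ _ _ _ hd (u ∘ f).
have [g2 hg2] := hP _ _ _ _ _ _ hd (t ∘ f).
(* Along [x] this restricts to [(v u - w t) f = f]. *)
exists (v ∘ g1 + - (w ∘ g2)).
rewrite compmDl compNm -!compmA hg1 hg2 !compmA huv compmDl comp1m.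
by rewrite addrK.
Qed.

Lemma stable_retract_cosyzygy (G H I J G' H' : C) (k : mor G I) (q : mor I G')
    (l : mor H J) (r : mor J H') :
  conflation s k q -> conflation s l r ->
  injective_object s I -> injective_object s J ->
  stable_retract G H -> stable_retract G' H'.
Proof.
move=> [d hd] [e he] hI hJ [u [v [P [t [w [hP huv]]]]]].
have [b hb] := hJ _ _ _ _ _ _ hd (l ∘ u).
have [u' [_ hu']] := extriangulated_ET3 hC hd he hb.
have [b' hb'] := hI _ _ _ _ _ _ he (k ∘ v).
have [v' [_ hv']] := extriangulated_ET3 hC he hd hb'.
have hpull : pull (v' ∘ u' - idm G') d = 0.
  have -> : pull (v' ∘ u' - idm G') d = pull (v' ∘ u') d - d.
    apply: (addIr (pull (idm G') d)).
    by rewrite /pull -ext_mapDl ext_map_id !subrK.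
  rewrite pull_comp -hv' pull_push -hu' -push_comp huv.
  have -> : push (idm G + w ∘ t) d = d + push (w ∘ t) d.
    by rewrite /push ext_mapDr ext_map_id.
  rewrite push_comp (push_into_injective t hd hP) addrC addKr.
  exact: raddf0.
have [z hz] := deflation_lift hd hpull.
(* The new factorization goes through [I] itself: [v' u' - 1 = q z]. *)
by exists u', v', I, z, q; split=> //; rewrite hz addrC subrK.
Qed.

Lemma stable_retract_iso (E G H : C) (f : mor E G) (g : mor E H) (P : C) :
  injective_object s P -> is_iso f -> is_iso g -> stable_retract G H.
Proof.
move=> hP [f' [_ hf]] [g' [hg _]].
exists (g ∘ f'), (f ∘ g'), P, 0, 0; split=> //.
by rewrite comp0m addr0 compmA -(compmA f) hg compm1.
Qed.

(* Stating [G 0 = E] as an equation lets the induction prepend a conflation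
   without having to know that conflations are closed under isomorphism. *)
Lemma injective_resolution (hinj : enough_injectives s) (n : nat) (E : C) :
  exists (G I : nat -> C) (k : forall m, mor (G m) (I m))
    (q : forall m, mor (I m) (G m.+1)) (p : mor (I n) (I n.+1)),
    [/\ G 0%N = E,
        forall m, (m < n)%N -> conflation s (k m) (q m),
        conflation s (k n) p
      & forall m, (m <= n)%N -> injective_object s (I m)].
Proof.
elim: n E => [|n IHn] E; have [J [X [x [y [d [hJ hd]]]]]] := hinj E.
  (* Zero maps fill the indices outside the single conflation; [I 1] is only the target of [p], with
     no injectivity claimed. *)
  pose G m := if m is _.+1 then X else E.
  pose I m := if m is _.+1 then X else J.
  exists G, I, (fun m => if m is 0 return mor (G m) (I m) then x else 0),
    (fun=> 0), y.
  by split=> //; [exists d | case].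
have [G [I [k [q [p [hG hkq hkp hI]]]]]] := IHn X; subst X.
pose G' m := if m is m'.+1 then G m' else E.
pose I' m := if m is m'.+1 then I m' else J.
exists G', I',
  (fun m => if m is m'.+1 return mor (G' m) (I' m) then k m' else x),
  (fun m => if m is m'.+1 return mor (I' m) (G' m.+1) then q m' else y), p.
split=> //; case=> [|m]; rewrite ?ltnS //; [|exact: hkq|exact: hI].
by exists d.
Qed.

End InjectiveDimension.

Theorem theorem3p7 (C : additive_category) (Ext : additive_bifunctor C)
    (s : correspondence Ext) (hC : extriangulated s)
    (hinj : enough_injectives s) (n : nat) (hn : (1 <= n)%N) (E : C) :
  (forall (I : nat -> C) (F : C) (i : mor E (I 0%N))
      (d : forall m : nat, mor (I m) (I m.+1)) (p : mor (I n.-1) F),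
    admissible_exact s i d p ->
    (forall m : nat, (m < n)%N -> injective_object s (I m)) ->
    injective_object s F)
  <->
  (exists (I : nat -> C) (i : mor E (I 0%N))
      (d : forall m : nat, mor (I m) (I m.+1)) (p : mor (I n.-1) (I n)),
    admissible_exact s i d p /\
    (forall m : nat, (m <= n)%N -> injective_object s (I m))).
Proof.
case: n hn => // n _ /=; split.
  move=> hF.
  have [G [I [k [q [p [hG hkq hkp hI]]]]]] := injective_resolution hinj n E.
  subst E.
  have hex : admissible_exact s (n := n.+1) (k 0%N)
      (fun m => k m.+1 ∘ q m) p.
    exists G, k, q, (idm _); split=> //; last by rewrite compm1.
    by exists (idm _); rewrite compm1.
  exists I, (k 0%N), (fun m => k m.+1 ∘ q m), p; split=> // m.
  (* Only the end term [I n.+1] is not injective by construction; (i) supplies it. *)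
  by rewrite leq_eqVlt => /orP[/eqP-> | /hI //]; exact: hF hex hI.
move=> [J [i [d [p [[H [l [r [psi [hlr hlp hpsi _ _]]]]] hJ]]]]].
move=> I F _ _ p' [G [k [q [phi [hkq hkp hphi _ _]]]]] hI.
have hGH m : (m <= n)%N -> stable_retract s (G m) (H m).
  (* Base case: [G 0] and [H 0] are both isomorphic to [E]. *)
  elim: m => [_|m IHm hm]; first exact: stable_retract_iso (hJ 0%N _) hphi hpsi.
  apply: (stable_retract_cosyzygy hC (hkq m hm) (hlr m hm)).
  - by apply: hI; exact: ltnW.
  - by apply: hJ; exact: leqW (ltnW hm).
  - exact: IHm (ltnW hm).
(* The final conflations end in [F] and [J n.+1], so one more cosyzygy step makes [F] a stable
   retract of [J n.+1]. *)
apply: stable_retract_injective (hJ n.+1 (leqnn _)).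
exact: (stable_retract_cosyzygy hC hkp hlp (hI n (leqnn _)) (hJ n (leqnSn _))
  (hGH n (leqnn _))).
Qed.
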